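(* Let $G\cong \mathrm{Sp}_6(\mathbb{F}_2)$ and let $U_{36}\subset G$ be its subgroup of index 36. If two subgroups $U_1, U_2 \subseteq U_{36}$ are conjugate in $G$, then they are conjugate already in $U_{36}$.
   Context: $\mathrm{Sp}_6(\mathbb{F}_2)$ is the simple group of order $1\,451\,520$. It has a maximal subgroup $U_{36}$ of index 36, unique up to conjugation and isomorphic to the symmetric group $S_8$. *)

(* Defs.v *)
From HB Require Import structures.
From mathcomp Require Import all_boot all_order all_algebra all_fingroup.

Set Implicit Arguments.
Unset Strict Implicit.
Unset Printing Implicit Defensive.

Import GRing.Theory.
Import GroupScope.
Local Open Scope ring_scope.

(* The Gram matrix of the standard symplectic form on F_2^6, in a basis
   e_1, e_2, e_3, f_1, f_2, f_3 with e_i paired with f_i. *)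
Definition symplectic_form : 'M['F_2]_6 :=
  (block_mx 0 1%:M (- 1%:M) 0 : 'M['F_2]_(3 + 3)).

(* Sp_6(F_2), acting on row vectors: (u g) J (v g)^T = u J v^T. *)
Definition Sp6F2 : {set {'GL_6(2)}} :=
  [set g : {'GL_6(2)} |
    GLval g *m symplectic_form *m (GLval g)^T == symplectic_form].

Lemma Sp6F2_group_set : group_set Sp6F2.
Proof.
apply/group_setP; split=> [|g h].
  by rewrite inE GL_1E (mul1mx symplectic_form) trmx1 mulmx1.
rewrite !inE => /eqP gJ /eqP hJ.
rewrite GL_MxE trmx_mul.
have -> : forall A B J : 'M['F_2]_6,
    A *m B *m J *m (B^T *m A^T) = A *m (B *m J *m B^T) *m A^T.
  by move=> A B J; rewrite !mulmxA.
by rewrite hJ gJ.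
Qed.

Canonical Sp6F2_group : {group {'GL_6(2)}} := Group Sp6F2_group_set.

(* H and K are conjugate by an element of A. *)
Definition conjugate_in (gT : finGroupType) (A H K : {set gT}) : Prop :=
  exists2 g : gT, g \in A & K = (H :^ g)%g.

(* Main.v *)
Require Import Defs.
From mathcomp Require Import all_boot all_order all_algebra all_fingroup.
From mathcomp Require Import all_solvable.
From mathcomp Require Import zify.
Import GroupScope.

Set Implicit Arguments.
Unset Strict Implicit.

(* Sp_6(2) acts on the 64 quadratic forms q on V = F_2^6 that polarize to the
   symplectic form B; any two of them differ by a functional B(a, _).

   A subgroup H of index 36 is the stabilizer of one of the 36 forms of plus
   type. Indeed 35 divides |H|, and an element x of order 7, resp. y of order
   5, of H fixes exactly one of these 36 forms, so the orbit O of the form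
   fixed by x satisfies |O| = 1 mod 7 and |O| = 0 or 1 mod 5; hence |O| is 1,
   15 or 36. If |O| is odd then the sum of the forms in O is an H-invariant
   form. If |O| = 36 then the Sylow 7-subgroups of the stabilizer in H give
   commuting elements of orders 5 and 7, which is absurd because the element
   of order 7 would then act on the 4 fixed vectors of the other one.

   Stabilizers of forms control fusion: if U fixes q as well as its conjugate
   q' = q + B(a, _) of the same type, then q(a) = 0 and U fixes a, so the
   transvection with centre a centralizes U and maps q to q'. *)

(** * The symplectic space F_2^6 and counts of its vectors *)

Section SymplecticSpace.
Import GRing.Theory.
Local Open Scope ring_scope.

Notation V := 'rV['F_2]_6.

Lemma F2_cases (x : 'F_2) : x = 0 \/ x = 1.
Proof. by case: x => [[|[|//]] lt_x]; [left | right]; apply: val_inj. Qed.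

Lemma F2_neq0 (x : 'F_2) : (x != 0) = (x == 1).
Proof. by case: (F2_cases x) => ->. Qed.

Lemma addF2 (x : 'F_2) : x + x = 0.
Proof. by case: (F2_cases x) => ->; apply: val_inj. Qed.

Lemma addF2K (x y : 'F_2) : x + y + y = x.
Proof. by rewrite -addrA addF2 addr0. Qed.

Lemma oppF2 (x : 'F_2) : - x = x.
Proof. by apply/eqP; rewrite eq_sym -subr_eq0 opprK addF2. Qed.

Lemma addV2 (v : V) : v + v = 0.
Proof. by apply/rowP=> i; rewrite !mxE addF2. Qed.

Lemma addV2K (u v : V) : u + v + v = u.
Proof. by rewrite -addrA addV2 addr0. Qed.

Definition sform (u v : V) : 'F_2 := (u *m symplectic_form *m v^T) 0 0.

Lemma sformDl u v w : sform (u + v) w = sform u w + sform v w.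
Proof. by rewrite /sform !mulmxDl mxE. Qed.

Lemma sformDr u v w : sform u (v + w) = sform u v + sform u w.
Proof. by rewrite /sform linearD mulmxDr mxE. Qed.

Lemma sformZr u b v : sform u (b *: v) = b * sform u v.
Proof. by rewrite /sform linearZ -scalemxAr mxE. Qed.

Lemma sform0r u : sform u 0 = 0.
Proof. by rewrite /sform linear0 mulmx0 mxE. Qed.

(** A concrete plus-type form. Its polarization identity also yields that [sform] is alternating and
    symmetric. *)
Definition hyperbolic_form (v : V) : 'F_2 :=
  (lsubmx (v : 'rV_(3 + 3)) *m (rsubmx (v : 'rV_(3 + 3)))^T) 0 0.

Lemma hyperbolic_form_row (a b : 'rV['F_2]_3) :
  hyperbolic_form (row_mx a b) = (a *m b^T) 0 0.
Proof. by rewrite /hyperbolic_form row_mxKl row_mxKr. Qed.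

Lemma sform_row (a b c d : 'rV['F_2]_3) :
  sform (row_mx a b) (row_mx c d) = (a *m d^T) 0 0 + (b *m c^T) 0 0.
Proof.
transitivity ((row_mx a b *m block_mx 0 1%:M (- 1%:M) 0
               *m (row_mx c d : 'rV_(3 + 3))^T) 0 0); first by [].
rewrite tr_row_mx mul_row_block mul_row_col mxE addrC.
rewrite !mulmx0 add0r addr0 !mulmx1 mulmxN mulmx1 mulNmx.
by rewrite [fun_of_matrix (- _) _ _]mxE oppF2.
Qed.

Lemma dotC (a b : 'rV['F_2]_3) : (a *m b^T) 0 0 = (b *m a^T) 0 0.
Proof. by rewrite -[in LHS](trmxK a) -trmx_mul mxE. Qed.

Lemma hyperbolic_formD (u v : V) :
  hyperbolic_form (u + v) = hyperbolic_form u + hyperbolic_form v + sform u v.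
Proof.
rewrite -[u](@hsubmxK _ 1 3 3) -[v](@hsubmxK _ 1 3 3).
move: (lsubmx _) (rsubmx _) (lsubmx _) (rsubmx _) => c d a b.
have -> : row_mx a b + row_mx c d = row_mx (a + c) (b + d) :> V.
  exact: (@add_row_mx _ 1 3 3).
rewrite sform_row !hyperbolic_form_row.
rewrite linearD /= mulmxDl !mulmxDr ![fun_of_matrix (_ + _) _ _]mxE (dotC b c).
by rewrite [X in _ + X = _]addrC addrACA.
Qed.

Lemma hyperbolic_form0 : hyperbolic_form 0 = 0.
Proof.
by have := hyperbolic_formD 0 0; rewrite addF2 addr0 add0r sform0r.
Qed.

Lemma sformxx u : sform u u = 0.
Proof.
by have := hyperbolic_formD u u; rewrite addV2 hyperbolic_form0 addF2 add0r.
Qed.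

Lemma sformC u v : sform u v = sform v u.
Proof.
have := hyperbolic_formD u v; rewrite addrC hyperbolic_formD.
by rewrite [hyperbolic_form v + _]addrC => /addrI.
Qed.

(** The square is -1, which is 1 in characteristic 2. An inverse of the Gram matrix gives
    nondegeneracy and represents functionals. *)
Lemma sqr_symplectic_form : symplectic_form *m symplectic_form = 1%:M.
Proof.
transitivity (block_mx 0 1%:M (- 1%:M) 0 *m block_mx 0 1%:M (- 1%:M) 0
              : 'M['F_2]_(3 + 3)); first by [].
rewrite mulmx_block.
rewrite !mul0mx !mulmx0 !mulNmx mulmxN !mul1mx !addr0 !add0r.
have -> : - 1%:M = 1%:M :> 'M['F_2]_3.
  by apply/matrixP=> i j; rewrite !mxE oppF2.
by rewrite -scalar_mx_block.
Qed.

Lemma sform_nondeg u : u != 0 -> exists w, sform u w = 1.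
Proof.
move=> nzu; have: u *m symplectic_form != 0.
  apply: contraNneq nzu => uJ0.
  by rewrite -[u]mulmx1 -sqr_symplectic_form mulmxA uJ0 mul0mx.
case/rV0Pn=> i; rewrite F2_neq0 => /eqP uJi.
exists (delta_mx 0 i); rewrite /sform trmx_delta.
by rewrite -colE mxE.
Qed.

Lemma sform_eq a b : sform a =1 sform b -> a = b.
Proof.
move=> eq_ab; apply/eqP; apply: contraT => neq_ab.
have [|w] := @sform_nondeg (a + b).
  apply: contraNneq neq_ab => ab0.
  by rewrite -[a](addV2K a b) ab0 add0r.
by rewrite sformDl eq_ab addF2.
Qed.

Lemma sform_nondeg2 u v : u != 0 -> v != 0 ->
  exists w, sform u w = 1 /\ sform v w = 1.
Proof.
move=> /sform_nondeg[w uw] /sform_nondeg[z vz].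
have [vw | vw] := F2_cases (sform v w); last by exists w.
have [uz | uz] := F2_cases (sform u z); last by exists z.
(* Each witness is orthogonal to the other vector, so their sum pairs to 1 with both. *)
by exists (w + z); rewrite !sformDr uw vz vw uz addr0 add0r.
Qed.

Lemma sform_repr (f : V -> 'F_2) :
  {morph f : u v / u + v} -> exists a, f =1 sform a.
Proof.
move=> fD; have f0: f 0 = 0.
  by apply: (addIr (f 0)); rewrite -fD !add0r.
pose r : V := \row_i f (delta_mx 0 i).
exists (r *m symplectic_form) => v.
rewrite /sform -[r *m _ *m _]mulmxA sqr_symplectic_form mulmx1.
rewrite {1}(row_sum_delta v) (big_morph f fD f0) mxE; apply: eq_bigr => i _.
rewrite !mxE; case: (F2_cases (v 0 i)) => ->.
  by rewrite scale0r f0 mulr0.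
by rewrite scale1r mulr1.
Qed.

Lemma card_V : #|{: V}| = 64%N.
Proof. by rewrite card_mx card_Fp. Qed.

(** If [a] has a coordinate 1, adding that basis vector to [b] exchanges the zeros with the
    non-zeros. *)
Lemma card_dot0 (a : 'rV['F_2]_3) :
  #|[set b : 'rV['F_2]_3 | (a *m b^T) 0 0 == 0]| = if a == 0 then 8%N else 4%N.
Proof.
have card3: #|{: 'rV['F_2]_3}| = 8%N by rewrite card_mx card_Fp.
case: eqP => [-> | /eqP/rV0Pn[i]].
  rewrite -card3 -cardsT; congr #|pred_of_set _|; apply/setP=> b.
  by rewrite !inE mul0mx mxE eqxx.
rewrite F2_neq0 => /eqP ai; set K := [set b | _].
pose s (b : 'rV['F_2]_3) := b + delta_mx 0 i.
have sK: s @: K = ~: K.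
  have sss: involutive s.
    by move=> b; apply/rowP=> j; rewrite !mxE -addrA addF2 addr0.
  apply/setP=> b; rewrite (can_imset_pre _ sss) !inE /s linearD /= mulmxDr.
  rewrite trmx_delta -colE [fun_of_matrix (_ + _) _ _]mxE.
  rewrite [fun_of_matrix (col _ _) _ _]mxE ai.
  by case: (F2_cases ((a *m b^T) 0 0)) => ->.
have: (#|K| + #|K| = 8%N)%N.
  rewrite -{2}(card_imset K (addIr (delta_mx 0 i))) sK.
  by rewrite cardsC card3.
by rewrite addnn => cardK; apply: double_inj.
Qed.

Lemma card_hyperbolic_zeros : #|[set v | hyperbolic_form v == 0]| = 36%N.
Proof.
pose f (p : 'rV['F_2]_3 * 'rV['F_2]_3) : V := row_mx p.1 p.2.
have f_inj: injective f.
  by move=> [a b] [c d] /(@eq_row_mx _ 1 3 3)[] /= -> ->.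
have ->: [set v | hyperbolic_form v == 0] =
         f @: [set p | (p.1 *m p.2^T) 0 0 == 0].
  apply/setP=> v; rewrite inE; apply/idP/imsetP => [qv | [[a b] + ->]].
    by exists (lsubmx (v : 'rV_(3 + 3)), rsubmx (v : 'rV_(3 + 3)));
       rewrite ?inE // /f hsubmxK.
  by rewrite inE hyperbolic_form_row.
rewrite card_imset // -sum1_card.
rewrite (eq_bigl (fun p => true && ((p.1 *m p.2^T) 0 0 == 0))); last first.
  by move=> p; rewrite inE.
rewrite -(pair_big_dep xpredT (fun a b => (a *m b^T) 0 0 == 0)
                      (fun _ _ => 1%N)).
rewrite (eq_bigr (fun a : 'rV['F_2]_3 => if a == 0 then 8%N else 4%N));
  last first => [a _|].
  by rewrite -card_dot0 -sum1_card; apply: eq_bigl => b; rewrite inE.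
(* The first half 0 contributes 8 and each of the 7 others 4: 8 + 7 * 4 = 36. *)
rewrite (bigD1 0) //= eqxx (eq_bigr (fun _ => 4)%N) => [|a /negbTE-> //].
by rewrite sum_nat_const cardC1 card_mx card_Fp.
Qed.

Lemma nonzero_member (A : {set V}) :
  0 \in A -> (1 < #|A|)%N -> exists2 u, u \in A & u != 0.
Proof.
move=> A0; rewrite (cardsD1 0) A0 ltnS => /card_gt0P[u].
by rewrite inE in_set1 => /andP[nzu Au]; exists u.
Qed.

(** Translation by [w] preserves [A] and exchanges the two values of [sform u]. *)
Lemma half_hyperplane (A : {set V}) u w :
    (forall v, v \in A -> v + w \in A) -> sform u w = 1 ->
  #|A| = #|[set v in A | sform u v == 0]|.*2 /\
  #|A| = #|[set v in A | sform u v == 1]|.*2.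
Proof.
move=> Aw uw; have wK: involutive (fun v => v + w) by move=> v; apply: addV2K.
set A0 := [set v in A | _]; set A1 := [set v in A | _ == 1].
have A01: A1 = (fun v => v + w) @: A0.
  apply/setP=> v; rewrite (can_imset_pre _ wK) !inE sformDr uw.
  have ->: (v + w \in A) = (v \in A).
    by apply/idP/idP=> /Aw; rewrite ?addV2K.
  by case: (F2_cases (sform u v)) => ->.
have c01: #|A1| = #|A0| by rewrite A01 card_imset //; apply: can_inj wK.
have ->: #|A| = (#|A0| + #|A1|)%N.
  rewrite -(cardsID A0 A); congr (_ + _)%N; congr #|pred_of_set _|.
    by apply/setIidPr/subsetP=> v; rewrite inE => /andP[].
  apply/setP=> v; rewrite !inE.
  by case: (v \in A); case: (F2_cases (sform u v)) => ->.
by rewrite c01 addnn.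
Qed.

End SymplecticSpace.

(** The orbits of the p-group generated by [x] have length 1 or a multiple of p. *)
Lemma card_fixed_mod (aT : finGroupType) (rT : finType)
    (to : {action aT &-> rT}) (X : {set rT}) p x :
    prime p -> #[x]%g = p -> (forall v, v \in X -> to v x \in X) ->
  #|X| = #|X :&: 'Fix_to[x]| %[mod p].
Proof.
move=> p_pr ox actX; rewrite -afix_cycle; apply: pgroup_fix_mod.
  by rewrite /pgroup -/(order x) ox pnat_id.
by rewrite cycle_subG !inE; apply/subsetP=> v /actX; rewrite inE.
Qed.

(** * Quadratic forms polarizing to the symplectic form *)

Section QuadraticForms.
Import GRing.Theory.
Local Open Scope ring_scope.

Notation V := 'rV['F_2]_6.
Implicit Types (u v a : V) (q : {ffun V -> 'F_2}).

Definition zeros q := [set v | q v == 0].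

(** Over F_2 the polarization identity already makes q quadratic: it forces q 0 = 0, and the only
    scalars are 0 and 1. *)
Definition forms :=
  [set q : {ffun V -> 'F_2} |
    [forall u, forall v, q (u + v) == q u + q v + sform u v]].

Lemma formsP q :
  reflect (forall u v, q (u + v) = q u + q v + sform u v) (q \in forms).
Proof.
rewrite inE; apply: (iffP forallP) => [qD u v | qD u].
  by apply/eqP; move/forallP: (qD u).
by apply/forallP=> v; apply/eqP.
Qed.

Lemma form0 q : q \in forms -> q 0 = 0.
Proof.
by move/formsP/(_ 0 0); rewrite addF2 addr0 add0r sform0r.
Qed.

Definition translate q a : {ffun V -> 'F_2} := [ffun v => q v + sform a v].

Lemma translateE q a v : translate q a v = q v + sform a v.
Proof. exact: ffunE. Qed.

Lemma translate_form q a : q \in forms -> translate q a \in forms.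
Proof.
move/formsP=> qD; apply/formsP=> u v; rewrite !translateE qD sformDr.
by rewrite addrAC (addrACA (q u)).
Qed.

(** The sum of two forms with the same polarization is additive, hence a functional [sform a]. *)
Lemma form_translate q q' :
  q \in forms -> q' \in forms -> exists a, q' = translate q a.
Proof.
move=> /formsP qD /formsP q'D.
have [|a qa] := @sform_repr (fun v => q v + q' v).
  by move=> u v; rewrite qD q'D addrACA addF2 addr0 addrACA.
by exists a; apply/ffunP=> v; rewrite translateE -qa addrA addF2 add0r.
Qed.

Lemma translate_inj q : injective (translate q).
Proof.
move=> a b /ffunP eq_ab; apply: sform_eq => v.
by have := eq_ab v; rewrite !translateE => /addrI.
Qed.

(** Completing the square: up to the constant q(a), a translated form is q after a shift of the
    argument, so its zeros can be counted. *)
Lemma translate_shift q a v : q \in forms ->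
  translate q a v = q (v + a) + q a.
Proof.
by move/formsP=> qD; rewrite translateE qD sformC [RHS]addrAC addF2K.
Qed.

Lemma card_zeros_translate q a : q \in forms ->
  #|zeros (translate q a)| =
    if q a == 0 then #|zeros q| else (64 - #|zeros q|)%N.
Proof.
move=> Qq; have addaK: involutive (fun v => v + a) by move=> v; apply: addV2K.
have qa0: #|[set v | q (v + a) == 0]| = #|zeros q|.
  rewrite -(card_imset (zeros q) (can_inj addaK)).
  congr #|pred_of_set _|; apply/setP=> v.
  by rewrite (can_imset_pre _ addaK) !inE.
rewrite -{1}qa0; case: eqP => [qa | /eqP].
  congr #|pred_of_set _|; apply/setP=> v.
  by rewrite !inE translate_shift // qa addr0.
rewrite F2_neq0 -qa0 -card_V => /eqP qa.
rewrite -(cardsC [set v | q (v + a) == 0]) addKn.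
congr #|pred_of_set _|; apply/setP=> v; rewrite !inE translate_shift // qa.
by case: (F2_cases (q (v + a))) => ->.
Qed.

(** The forms of plus type (Arf invariant 0), recognized by their number of zeros; the other type
    has 64 - 36 = 28. *)
Definition even_forms := [set q in forms | #|zeros q| == 36%N].

Lemma even_formsE q :
  (q \in even_forms) = (q \in forms) && (#|zeros q| == 36%N).
Proof. exact: in_set. Qed.

Lemma even_formP q : q \in even_forms -> q \in forms.
Proof. by rewrite even_formsE => /andP[]. Qed.

Lemma even_form_translate q a : q \in even_forms ->
  (translate q a \in even_forms) = (q a == 0).
Proof.
rewrite !even_formsE => /andP[Qq /eqP zq].
by rewrite translate_form // card_zeros_translate // zq; case: ifP.
Qed.


Lemma hyperbolic_even : finfun hyperbolic_form \in even_forms.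
Proof.
rewrite even_formsE; apply/andP; split.
  by apply/formsP=> u v; rewrite !ffunE hyperbolic_formD.
rewrite -card_hyperbolic_zeros; apply/eqP; congr #|pred_of_set _|.
by apply/setP=> v; rewrite !inE ffunE.
Qed.

Lemma even_forms_translates q :
  q \in even_forms -> even_forms = translate q @: zeros q.
Proof.
move=> Eq; apply/setP=> q'; apply/idP/imsetP => [Eq' | [a qa ->]].
  have [a def_q'] := form_translate (even_formP Eq) (even_formP Eq').
  by exists a; rewrite // inE -(even_form_translate a Eq) -def_q'.
by rewrite even_form_translate //; rewrite inE in qa.
Qed.

Lemma card_even_forms : #|even_forms| = 36%N.
Proof.
have Eq := hyperbolic_even.
rewrite (even_forms_translates Eq) card_imset; last exact: translate_inj.
by move: Eq; rewrite even_formsE => /andP[_ /eqP].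
Qed.

End QuadraticForms.

(** * The induced action on quadratic forms *)

Section SymplecticAction.
Import GRing.Theory.
Local Open Scope ring_scope.

Notation V := 'rV['F_2]_6.

(* S stands for Sp_6(2); the ambient group is kept abstract because conversion
   on elements of {'GL_6(2)} itself is prohibitively slow. *)
Variables (gT : finGroupType) (S : {group gT}) (vact : {action gT &-> V}).
Hypothesis vactD : forall g, {morph vact^~ g : u v / u + v}.
Hypothesis sform_vact :
  forall g u v, g \in S -> sform (vact u g) (vact v g) = sform u v.

Implicit Types (u v a : V) (g : gT) (q : {ffun V -> 'F_2}).

Definition qact q g : {ffun V -> 'F_2} := [ffun v => q (vact v g^-1%g)].

Lemma qactE q g v : qact q g v = q (vact v g^-1%g).
Proof. exact: ffunE. Qed.

Lemma qact1 : qact^~ 1%g =1 id.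
Proof. by move=> q; apply/ffunP=> v; rewrite qactE invg1 act1. Qed.

Lemma qactM q : act_morph qact q.
Proof. by move=> g h; apply/ffunP=> v; rewrite !qactE invMg actM. Qed.

Canonical qaction := TotalAction qact1 qactM.

Lemma qact_fixP q g : reflect (forall v, q (vact v g) = q v) (qact q g == q).
Proof.
apply: (iffP eqP) => [qg v | qg].
  by rewrite -{1}qg qactE (actK vact).
by apply/ffunP=> v; rewrite qactE -qg (actKV vact).
Qed.

Lemma card_zeros_qact q g : #|zeros (qact q g)| = #|zeros q|.
Proof.
have ->: zeros (qact q g) = vact^~ g @: zeros q.
  apply/setP=> v; rewrite inE qactE; apply/idP/imsetP => [qv | [u qu ->]].
    by exists (vact v g^-1%g); rewrite ?inE // (actKV vact).
  by rewrite (actK vact); rewrite inE in qu.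
by rewrite card_imset //; apply: act_inj.
Qed.

Lemma forms_act q g : g \in S -> (qact q g \in forms) = (q \in forms).
Proof.
have sub q1 h : h \in S -> q1 \in forms -> qact q1 h \in forms.
  move=> Sh /formsP q1D; apply/formsP=> u v.
  by rewrite !qactE vactD q1D sform_vact ?groupV.
move=> Sg; apply/idP/idP; last exact: sub.
by move/(sub _ _ (groupVr Sg)); rewrite (actK qaction).
Qed.

(** The action is affine over the action on vectors: an element fixing both q and [translate q a]
    fixes [a]. *)
Lemma qact_translate q a g : g \in S ->
  qact (translate q a) g = translate (qact q g) (vact a g).
Proof.
move=> Sg; apply/ffunP=> v; rewrite qactE !translateE qactE; congr (_ + _).
by rewrite -(sform_vact _ _ Sg) (actKV vact).
Qed.

Lemma even_forms_act q g : g \in S ->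
  (qact q g \in even_forms) = (q \in even_forms).
Proof. by move=> Sg; rewrite !even_formsE forms_act // card_zeros_qact. Qed.


(** * Transvections and transitivity on singular vectors *)

Variable transv : V -> gT.
Hypothesis transv_in : forall a, transv a \in S.
Hypothesis vact_transv :
  forall a v, vact v (transv a) = v + sform v a *: a.
Hypothesis vact_faithful : forall g, vact^~ g =1 id -> g = 1%g.
(* The bound is |GL_6(2)|, with the factor 36 ^ 2 pulled out. *)
Hypothesis dvd_cardS : (#|S| %| 36 * 36 * (2 ^ 11 * 5 * 7 ^ 2 * 31))%N.

Lemma vact0 g : vact 0 g = 0.
Proof. by apply: (addIr (vact 0 g)); rewrite -vactD !add0r. Qed.

Lemma vact_eq g h : vact^~ g =1 vact^~ h -> g = h.
Proof.
move=> gh; apply: (mulIg h^-1%g); rewrite mulgV.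
by apply: vact_faithful => v; rewrite actM gh actK.
Qed.

Lemma vact_transvV a v : vact v (transv a)^-1%g = v + sform v a *: a.
Proof.
apply: (act_inj vact (transv a)); rewrite actKV vact_transv.
case: (F2_cases (sform v a)) => va.
  by rewrite va !scale0r !addr0 va scale0r addr0.
by rewrite va !scale1r sformDl va sformxx addr0 scale1r addV2K.
Qed.

(** With b = B(v, a), q(v + b a) = q(v) + b (q(a) + 1). So a singular centre translates q by [a],
    and a nonsingular one fixes q. *)
Lemma qact_transv q a : q \in forms -> q a = 0 ->
  qact q (transv a) = translate q a.
Proof.
move=> /formsP qD qa; apply/ffunP=> v.
rewrite qactE vact_transvV translateE [sform a v]sformC.
case: (F2_cases (sform v a)) => va; rewrite va; first by rewrite scale0r !addr0.
by rewrite scale1r qD qa va addr0.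
Qed.

Lemma qact_transv_fix q a : q \in forms -> q a = 1 -> qact q (transv a) = q.
Proof.
move=> /formsP qD qa; apply/ffunP=> v; rewrite qactE vact_transvV.
case: (F2_cases (sform v a)) => va; rewrite va; first by rewrite scale0r addr0.
by rewrite scale1r qD qa va addF2K.
Qed.

Lemma transv_swap q u v : q \in forms -> q u = 0 -> q v = 0 -> sform u v = 1 ->
  exists2 g, g \in 'C_S[q | qaction] & vact u g = v.
Proof.
(* Here q(u + v) = 1, so this transvection preserves q. *)
move=> Qq qu qv uv; exists (transv (u + v)).
  rewrite inE transv_in; apply/astab1P; apply: qact_transv_fix => //.
  by rewrite (formsP _ Qq) qu qv uv !add0r.
by rewrite vact_transv sformDr sformxx uv add0r scale1r addrA addV2 add0r.
Qed.

Lemma zeros_transitive q u v : q \in forms -> u != 0 -> v != 0 ->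
  q u = 0 -> q v = 0 -> exists2 g, g \in 'C_S[q | qaction] & vact u g = v.
Proof.
move=> Qq nzu nzv qu qv; have qD := formsP _ Qq.
have [uv | uv] := F2_cases (sform u v); last exact: transv_swap.
(* Orthogonal [u] and [v] are joined by two swaps through a singular [w] orthogonal to neither. *)
suff [w [qw uw wv]] : exists w, [/\ q w = 0, sform u w = 1 & sform w v = 1].
  have [g Cg ug] := transv_swap Qq qu qw uw.
  have [h Ch wh] := transv_swap Qq qw qv wv.
  by exists (g * h)%g; rewrite ?groupM ?actM ?ug.
have [w [uw vw]] := sform_nondeg2 nzu nzv.
have [qw | qw] := F2_cases (q w); first by exists w; split; rewrite // sformC.
exists (w + u); split; first by rewrite qD qw qu sformC uw addr0 addF2.
  by rewrite sformDr uw sformxx addr0.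
by rewrite sformDl uv addr0 sformC.
Qed.

(** The 36 - 1 nonzero singular vectors form one orbit of the stabilizer. *)
Lemma dvd35_stab q : q \in even_forms -> (35 %| #|'C_S[q | qaction]|)%N.
Proof.
rewrite even_formsE => /andP[Qq /eqP card_q].
have z0: 0 \in zeros q by rewrite inE form0.
pose Z := zeros q :\ 0; have card35: #|Z| = 35%N.
  by apply/eqP; rewrite -(eqn_add2l (0 \in zeros q)) -cardsD1 card_q z0.
have /card_gt0P[u] : (0 < #|Z|)%N by rewrite card35.
rewrite !inE => /andP[nzu /eqP qu].
rewrite -card35; suff ->: Z = orbit vact 'C_S[q | qaction] u.
  exact: dvdn_orbit.
apply/setP=> v; rewrite !inE; apply/andP/orbitP => [[nzv /eqP qv] | [g + <-]].
  exact: zeros_transitive.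
rewrite inE => /andP[Sg /astab1P qg]; split.
  by apply: contraNneq nzu => ug; rewrite -(actK vact g u) ug vact0.
by rewrite (elimT (qact_fixP q g)) ?qu //; apply/eqP.
Qed.

(** * Vectors and forms fixed by elements of prime order *)

Lemma fixD g u v :
  u \in 'Fix_vact[g] -> v \in 'Fix_vact[g] -> u + v \in 'Fix_vact[g].
Proof. by move=> /afix1P ug /afix1P vg; apply/afix1P; rewrite vactD ug vg. Qed.

Lemma fix0 g : 0 \in 'Fix_vact[g].
Proof. by apply/afix1P; apply: vact0. Qed.

Lemma card_fix_dvd g : (#|'Fix_vact[g]| %| 64)%N.
Proof.
have grF: group_set 'Fix_vact[g].
  by apply/group_setP; split=> [|u v]; [apply: fix0 | apply: fixD].
rewrite -card_V -cardsT; exact: (cardSg (subsetT (Group grF))).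
Qed.

Lemma card_fix_mod p g : prime p -> #[g]%g = p -> 64 = #|'Fix_vact[g]| %[mod p].
Proof.
move=> p_pr og; rewrite -card_V -cardsT.
by rewrite (@card_fixed_mod _ _ vact _ p g p_pr og) ?setTI.
Qed.

Lemma card_fix64 g : #|'Fix_vact[g]| = 64%N -> g = 1%g.
Proof.
move=> card64; apply: vact_faithful => v; apply/afix1P.
suff ->: 'Fix_vact[g] = [set: V] by rewrite inE.
by apply/eqP; rewrite eqEcard subsetT cardsT card_V card64.
Qed.

(** The 32 vectors pairing to 1 with [c] are permuted by [g], and an odd prime does not divide 32.
    So [sform] is nondegenerate on the fixed space. *)
Lemma fix_nondeg p g c : g \in S -> prime p -> odd p -> #[g]%g = p ->
    c \in 'Fix_vact[g] -> c != 0 ->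
  exists2 w, w \in 'Fix_vact[g] & sform c w = 1.
Proof.
move=> Sg p_pr p_odd og /afix1P gc nzc; have [w cw] := sform_nondeg nzc.
pose X := [set v in [set: V] | sform c v == 1].
have card32: #|X| = 32%N.
  have [_] := @half_hyperplane setT c w (fun _ _ => in_setT _) cw.
  by rewrite cardsT card_V -[64%N]/(32.*2) => /double_inj.
have mod_p: #|X| = #|X :&: 'Fix_vact[g]| %[mod p].
  apply: (card_fixed_mod p_pr og) => v.
  by rewrite !inE /= -{2}gc (sform_vact _ _ Sg).
have [X0 | [v]] := set_0Vmem (X :&: 'Fix_vact[g]).
  move: mod_p p_odd; rewrite card32 X0 cards0 mod0n => /eqP.
  rewrite -/(p %| 2 ^ 5)%N Euclid_dvdX // andbT (dvdn_prime2 p_pr) //.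
  by move/eqP->.
by case/setIP; rewrite !inE /= => /eqP cv Fv; exists v; rewrite ?inE.
Qed.

Lemma card_fix_cases p g : prime p -> #[g]%g = p ->
  exists k : 'I_6, #|'Fix_vact[g]| = (2 ^ k)%N /\ (2 ^ k == 64 %[mod p])%N.
Proof.
move=> p_pr og; have fix_lt64: #|'Fix_vact[g]| != 64%N.
  by apply: contraTneq p_pr => /card_fix64 g1; rewrite -og g1 order1.
have /(@dvdn_pfactor 2 _ 6 isT)[k le_k6 Fk] := card_fix_dvd g.
have lt_k6: (k < 6)%N.
  rewrite ltn_neqAle le_k6 andbT; apply: contraNneq fix_lt64 => k6.
  by rewrite Fk k6.
exists (Ordinal lt_k6); split=> //=.
by rewrite (card_fix_mod p_pr og) Fk.
Qed.

(** Only 2 ^ 1 is congruent to 64 modulo 31, so the fixed space would be a line, which carries no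
    nondegenerate alternating form. *)
Lemma no_order31 g : g \in S -> #[g]%g != 31%N.
Proof.
move=> Sg; apply/eqP=> og; have [k [Fk mod_k]] := @card_fix_cases 31 g isT og.
have{k mod_k Fk} F2: #|'Fix_vact[g]| = 2%N.
  by rewrite Fk; case: k mod_k {Fk} => [[|[|[|[|[|[|k]]]]]] lt_k].
have [|c Fc nzc] := @nonzero_member 'Fix_vact[g] (fix0 g); first by rewrite F2.
have [w Fw cw] := @fix_nondeg 31 g c Sg isT isT og Fc nzc.
have /subset_leq_card : 0 |: [set c; w] \subset 'Fix_vact[g].
  by rewrite !subUset !sub1set fix0 Fc.
rewrite F2 cardsU1 cards2 !inE [0 == c]eq_sym (negbTE nzc) /=.
have ->: (c != w) by apply/eqP=> def_w; move: cw; rewrite -def_w sformxx.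
suff /negbTE->: (0 != w) by [].
by apply/eqP=> def_w; move: cw; rewrite -def_w sform0r.
Qed.

Lemma fix_order7 g : g \in S -> #[g]%g = 7%N -> 'Fix_vact[g] = [set 0].
Proof.
move=> Sg og; have [k [Fk mod_k]] := @card_fix_cases 7 g isT og.
set C := 'Fix_vact[g] in Fk *.
have C0: 0 \in C by apply: fix0.
(* Since 64 = 1 modulo 7, the exponent of 2 is 0 or 3. *)
have [C1 | F8]: #|C| = 1%N \/ #|C| = 8%N.
  by rewrite Fk; case: k mod_k {Fk} => [[|[|[|[|[|[|k]]]]]] lt_k] //;
     [left | right].
  by apply/eqP; rewrite eq_sym eqEcard sub1set C0 C1 cards1.
have nondeg c : c \in C -> c != 0 -> exists2 w, w \in C & sform c w = 1.
  exact: (@fix_nondeg 7).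
(* A nondegenerate alternating form lives in even dimension: split off a
   hyperbolic plane <u, w> from C and look at the remaining line D. *)
have [|u Cu nzu] := @nonzero_member C C0; first by rewrite F8.
have [w Cw uw] := nondeg u Cu nzu.
have [|cC _] := @half_hyperplane C u w _ uw.
  by move=> v Cv; apply: fixD.
set A := [set v in C | _] in cC.
have wu: sform w u = 1 by rewrite sformC.
have [|cA _] := @half_hyperplane A w u _ wu.
  move=> v /setIdP[Cv /eqP uv]; apply/setIdP; split; first exact: fixD.
  by rewrite sformDr uv sformxx addr0.
set D := [set v in A | _] in cA.
have cD: #|D| = 2%N.
  by apply: double_inj; apply: double_inj; rewrite -cA -cC F8.
have inD v : (v \in D) = (v \in C) && (sform u v == 0) && (sform w v == 0).
  by rewrite !in_set.
have D0: 0 \in D by rewrite inD C0 !sform0r.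
have [|z Dz nzz] := @nonzero_member D D0; first by rewrite cD.
have [Cz /eqP uz /eqP wz]: [/\ z \in C, sform u z == 0 & sform w z == 0].
  by move: Dz; rewrite inD => /andP[/andP[]].
have [t Ct zt] := nondeg z Cz nzz.
(* The projection of [t] to the orthogonal complement of the plane spanned by [u] and [w]. *)
pose t' := t + sform w t *: u + sform u t *: w.
have CZ b v : v \in C -> b *: v \in C.
  by case: (F2_cases b) => ->; rewrite ?scale0r ?scale1r.
have Ct': t' \in C by rewrite !fixD ?CZ.
have Dt': t' \in D.
  rewrite inD Ct' /= !sformDr !sformZr !sformxx uw wu !mulr0 !mulr1 !addr0.
  by rewrite addF2 addF2 eqxx.
have zt': sform z t' = 1.
  by rewrite !sformDr !sformZr zt !(sformC z) uz wz !mulr0 !addr0.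
have /eqP defD: [set 0; z] == D.
  by rewrite eqEcard subUset !sub1set D0 Dz cards2 cD eq_sym nzz.
move: Dt'; rewrite -defD !inE => /orP[] /eqP t'E.
  by rewrite t'E sform0r in zt'.
by rewrite t'E sformxx in zt'.
Qed.

Lemma card_fix_order5 g : #[g]%g = 5%N -> #|'Fix_vact[g]| = 4%N.
Proof.
move=> og; have [k [-> mod_k]] := @card_fix_cases 5 g isT og.
by case: k mod_k => [[|[|[|[|[|[|k]]]]]] lt_k].
Qed.

Lemma orders_5_7_not_commute x y : x \in S ->
  #[x]%g = 7%N -> #[y]%g = 5%N -> ~ commute x y.
Proof.
move=> Sx ox oy cxy.
have actx v : v \in 'Fix_vact[y] -> vact v x \in 'Fix_vact[y].
  by move/afix1P=> yv; apply/afix1P; rewrite -actM cxy actM yv.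
have := card_fixed_mod (isT : prime 7) ox actx.
rewrite (fix_order7 Sx ox) card_fix_order5 //.
have := subset_leq_card (subsetIr 'Fix_vact[y] [set 0%R]); rewrite cards1.
by case: #|_| => [|[|]].
Qed.

(** Fixed forms differ by fixed vectors, so there are at most 4, resp. 1, of them; their number is
    36 = 1 modulo the order of [x]. *)
Lemma card_even_fix x : x \in S -> #[x]%g = 5%N \/ #[x]%g = 7%N ->
  #|even_forms :&: 'Fix_qaction[x]| = 1%N.
Proof.
move=> Sx ox.
have act_even q : q \in even_forms -> qact q x \in even_forms.
  by rewrite even_forms_act.
have le_fix : (#|even_forms :&: 'Fix_qaction[x]| <= #|'Fix_vact[x]|)%N.
  have [-> | [q /setIP[Eq /afix1P /= qx]]] :=
    set_0Vmem (even_forms :&: 'Fix_qaction[x]); first by rewrite cards0.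
  rewrite -(card_imset _ (@translate_inj q)) subset_leq_card //.
  apply/subsetP=> q' /setIP[Eq' /afix1P /= q'x].
  have [a def_q'] := form_translate (even_formP Eq) (even_formP Eq').
  rewrite def_q' imset_f //; apply/afix1P; apply: (@translate_inj q).
  by rewrite -{1}qx -qact_translate // -def_q'.
case: ox => ox.
  have := card_fixed_mod (to := qaction) (isT : prime 5) ox act_even.
  rewrite card_fix_order5 // in le_fix; rewrite card_even_forms.
  by case: #|_| le_fix => [|[|[|[|[|]]]]].
have := card_fixed_mod (to := qaction) (isT : prime 7) ox act_even.
rewrite (fix_order7 Sx ox) cards1 in le_fix; rewrite card_even_forms.
by case: #|_| le_fix => [|[|]].
Qed.

(** * Subgroups of index 36 are stabilizers of even forms *)

Lemma odd_orbit_fixed (H : {group gT}) (X : {set {ffun V -> 'F_2}}) :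
    X \subset forms -> odd #|X| -> [acts H, on X | qaction] ->
  exists2 q, q \in forms & H \subset 'C[q | qaction].
Proof.
move=> sXF oddX actX; exists [ffun v => \sum_(t in X) t v].
  apply/formsP=> u v; rewrite !ffunE -big_split.
  (* The sum of the forms polarizes to [#|X|] times [sform], and [#|X|] is odd. *)
  have ->: sform u v = \sum_(t in X) sform u v.
    rewrite sumr_const.
    suff ->: sform u v *+ #|X| = sform u v *+ odd #|X| by rewrite oddX.
    elim: #|X| => //= n IHn; rewrite mulrS IHn.
    by case: (odd n); rewrite /= ?addF2 ?addr0.
  rewrite -big_split; apply: eq_bigr => t Xt /=.
  by rewrite (formsP _ (subsetP sXF t Xt)).
apply/subsetP=> h Hh; apply/astab1P; apply/ffunP=> v /=.
rewrite qactE !ffunE [RHS](reindex_acts _ actX Hh).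
by apply: eq_bigr => t _; rewrite /= qactE.
Qed.


(* K stands for the stabilizer in H of an even form: its Sylow 7-subgroups are
   too few for an element of order 5 to permute them without fixed points, and
   an element of order 5 normalizing a 7-group of order at most 49 centralizes
   an element of order 7. *)
Lemma stabilizer_order_contra (K : {group gT}) : K \subset S ->
  (#|K| %| 2 ^ 11 * 5 * 7 ^ 2 * 31)%N -> (35 %| #|K|)%N -> False.
Proof.
move=> sKS dvdK dvd35.
have [y Ky oy] : {y | y \in K & #[y]%g = 5%N}.
  by apply: Cauchy => //; apply: dvdn_trans dvd35.
have dvd7K: (7 %| #|K|)%N by apply: dvdn_trans dvd35.
have{} dvdK: (#|K| %| 2 ^ 11 * 5 * 7 ^ 2)%N.
  rewrite -(@Gauss_dvdl _ _ 31) // coprime_sym prime_coprime //.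
  apply/negP=> /Cauchy[//|z Kz oz].
  by have := no_order31 (subsetP sKS z Kz); rewrite oz.
have act_Syl (R : {group gT}) : R \in 'Syl_7(K) -> ('JG R y)%act \in 'Syl_7(K).
  by rewrite !inE; rewrite pHallJ.
have modn7 := card_Syl_mod K (isT : prime 7).
have [Syl0 | [R /setIP[SylR /afix1P yR]]] :=
  set_0Vmem ('Fix_('Syl_7(K) | 'JG)[y]).
  have := card_fixed_mod (isT : prime 5) oy act_Syl.
  rewrite Syl0 cards0 mod0n => /eqP; rewrite -/(5 %| _)%N => dvd5.
  have co7: coprime #|'Syl_7(K)| (7 ^ 2).
    by rewrite coprimeXr // coprime_sym prime_coprime // /dvdn modn7.
  have: (#|'Syl_7(K)| %| 2 ^ 11 * 5)%N.
    by rewrite -(Gauss_dvdl _ co7) (dvdn_trans (card_Syl_dvd 7 K)).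
  case/dvdnP: dvd5 modn7 => m ->; rewrite dvdn_pmul2r // => mod7.
  case/(dvdn_pfactor _ 11 (isT : prime 2))=> k le_k11 mk.
  (* Powers of 2 are 1, 2 or 4 modulo 7, so 5 * 2 ^ k is 5, 3 or 6, never 1. *)
  move: mod7; rewrite {}mk.
  by do 12![case: k le_k11 => [|k] le_k11 //].
have sylR : 7.-Sylow(K) R by rewrite inE in SylR.
have [sRK pR _] := and3P sylR.
have cardR := card_Hall sylR; rewrite p_part in cardR.
have [k0 k2]: (0 < logn 7 #|K|)%N /\ (logn 7 #|K| <= 2)%N.
  rewrite logn_gt0 mem_primes dvd7K cardG_gt0; split=> //.
  rewrite -(@dvdn_Pexp2l 7) // -cardR -(@Gauss_dvdr _ (2 ^ 11 * 5)).
    exact: dvdn_trans (cardSg sRK) dvdK.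
  by rewrite cardR coprimeXl // prime_coprime // Euclid_dvdM // Euclid_dvdX.
have actR g : g \in R -> ('J g y)%act \in R.
  by move=> Rg; rewrite /= -(congr_group yR) memJ_conjg.
have := card_fixed_mod (isT : prime 5) oy actR.
rewrite cardR afixJ cent_set1 => mod5.
(* [R] has order 7 or 49, that is 2 or 4 modulo 5, so [y] centralizes more than the identity. *)
have ntC: 'C_R[y] != 1%g.
  apply/negP=> /eqP C1; move: mod5; rewrite C1 cards1.
  by case: (logn 7 #|K|) k0 k2 => [|[|[|]]].
have [_ dvdC _] := pgroup_pdiv (pgroupS (subsetIl R _) pR) ntC.
have [x /setIP[Rx /cent1P cxy] ox] := Cauchy (isT : prime 7) dvdC.
apply: (orders_5_7_not_commute (subsetP sKS x (subsetP sRK x Rx)) ox oy).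
exact: commute_sym.
Qed.

Lemma index36_fixes_form (H : {group gT}) : H \subset S ->
  #|S : H| = 36%N -> exists2 q, q \in even_forms & H \subset 'C[q | qaction].
Proof.
move=> sHS indexH; have cardS := Lagrange sHS; rewrite indexH in cardS.
have dvd35: (35 %| #|H|)%N.
  rewrite -(@Gauss_dvdl _ _ 36) // cardS.
  exact: dvdn_trans (dvd35_stab hyperbolic_even) (cardSg (subsetIl S _)).
have [y Hy oy] : {y | y \in H & #[y]%g = 5%N}.
  by apply: Cauchy => //; apply: dvdn_trans dvd35.
have [x Hx ox] : {x | x \in H & #[x]%g = 7%N}.
  by apply: Cauchy => //; apply: dvdn_trans dvd35.
have [Sx Sy] := (subsetP sHS x Hx, subsetP sHS y Hy).
have /eqP/cards1P[qx fix_x] := card_even_fix Sx (or_intror ox).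
have: qx \in even_forms :&: 'Fix_qaction[x] by rewrite fix_x set11.
case/setIP=> Eqx /afix1P /= qxx.
pose O := orbit qaction H qx.
have actO : [acts H, on O | qaction] by apply: acts_orbit; apply: subsetT.
have sOE: O \subset even_forms.
  by apply/subsetP=> _ /orbitP[h Hh <-]; rewrite even_forms_act ?(subsetP sHS).
have sEF: even_forms \subset forms by apply/subsetP=> q /even_formP.
have actO1 h : h \in H -> forall q, q \in O -> qact q h \in O.
  by move=> Hh q; rewrite (actsP actO).
have mod7: #|O| = 1 %[mod 7].
  have := card_fixed_mod (to := qaction) (isT : prime 7) ox (actO1 x Hx).
  suff ->: O :&: 'Fix_qaction[x] = [set qx] by rewrite cards1.
  apply/eqP; rewrite eqEsubset -{1}fix_x setSI // sub1set inE orbit_refl.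
  exact/afix1P.
have mod5: (#|O| %% 5 <= 1)%N.
  rewrite (card_fixed_mod (to := qaction) (isT : prime 5) oy (actO1 y Hy)).
  apply: leq_trans (leq_mod _ _) _.
  apply: leq_trans (subset_leq_card (setSI _ sOE)) _.
  by rewrite (card_even_fix Sy (or_introl oy)).
have le_O: (#|O| <= 36)%N by rewrite -card_even_forms subset_leq_card.
have [O36 | nO36] := eqVneq #|O| 36%N.
  case: (@stabilizer_order_contra 'C_H[qx | qaction]%G).
  - exact: subset_trans (subsetIl _ _) sHS.
  (* One factor 36 is the index of [H], the other the length of [O]. *)
  - have := dvd_cardS; rewrite -cardS -(card_orbit_stab qaction H qx) -/O O36.
    by rewrite (mulnC (36 * _)%N) mulnA dvdn_pmul2l.
  move: dvd35; rewrite -(card_orbit_stab qaction H qx) -/O O36.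
  by rewrite Gauss_dvdr.
have oddO : odd #|O|.
  move: mod7 mod5 le_O nO36; move: #|O| => n.
  by do 37!case: n => [|n] //.
have [q Fq Hq] := odd_orbit_fixed (subset_trans sOE sEF) oddO actO.
exists q => //.
(* The type of [q] is still open. As [x] fixes [q] and [qx], it fixes their difference [a], which is
   therefore 0. *)
have [a def_q] := form_translate (even_formP Eqx) Fq.
suff a0: a = 0 by rewrite def_q even_form_translate // a0 form0 // even_formP.
apply/set1P; rewrite -(fix_order7 Sx ox); apply/afix1P.
apply: (@translate_inj qx); rewrite -{1}qxx -qact_translate // -def_q.
exact/astab1P/(subsetP Hq).
Qed.

Lemma index36_stabilizer (H : {group gT}) : H \subset S ->
  #|S : H| = 36%N -> exists2 q, q \in even_forms & H :=: 'C_S[q | qaction].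
Proof.
move=> sHS indexH; have [q Eq Hq] := index36_fixes_form sHS indexH.
exists q => //; have sHC: H \subset 'C_S[q | qaction] by rewrite subsetI sHS.
(* Transvections with singular centres already carry [q] to every even form, so its stabilizer has
   index at least 36. *)
have orbq: (36 <= #|orbit qaction S q|)%N.
  rewrite -card_even_forms (even_forms_translates Eq) subset_leq_card //.
  apply/subsetP=> _ /imsetP[a qa ->]; rewrite inE in qa.
  apply/orbitP; exists (transv a); rewrite ?transv_in //=.
  by apply: qact_transv; [apply: even_formP | apply/eqP].
apply/eqP; rewrite eqEsubset sHC -indexg_eq1 eqn_leq indexg_gt0 andbT.
have := Lagrange_index (subsetIl S 'C[q | qaction]) sHC.
rewrite indexH -card_orbit => /eq_leq le36.
rewrite -(@leq_pmul2l 36) // muln1; apply: leq_trans le36.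
by rewrite leq_mul2r orbq orbT.
Qed.

(** * Fusion in the stabilizer of an even form *)

Lemma stabilizer_controls_fusion q (U : {group gT}) g :
    q \in even_forms -> g \in S -> U \subset 'C_S[q | qaction] ->
    U :^ g \subset 'C_S[q | qaction] ->
  exists2 h, h \in 'C_S[q | qaction] & U :^ g = U :^ h.
Proof.
move=> Eq Sg /subsetIP[sUS Uq] /subsetIP[_ Ugq].
have Eq': qact q g^-1 \in even_forms by rewrite even_forms_act ?groupV.
have [a def_q'] := form_translate (even_formP Eq) (even_formP Eq').
have qa: q a = 0 by apply/eqP; rewrite -even_form_translate // -def_q'.
have Ua h : h \in U -> vact a h = a.
  move=> Uh; apply: (@translate_inj q).
  have /astab1P /= qh := subsetP Uq h Uh.
  rewrite -{1}qh -qact_translate ?(subsetP sUS) // -def_q'.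
  have /(subsetP Ugq)/astab1P /= qhg: (h ^ g)%g \in U :^ g.
    by rewrite memJ_conjg.
  apply: (act_inj qaction g); rewrite (actKV qaction).
  by rewrite -[RHS]qhg -!(actM qaction) /conjg !mulgA.
(* The transvection takes [q] to its image under the inverse of [g], and [g] takes that back to
   [q]. *)
exists (transv a * g)%g.
  rewrite inE groupM //=; apply/astab1P; rewrite actM /=.
  by rewrite qact_transv ?even_formP // -def_q' (actKV qaction).
rewrite conjsgM; congr (_ :^ g); apply/esym/normP.
apply: (subsetP (cent_sub _)); apply/centP=> h Uh.
apply: vact_eq => v; rewrite !actM !vact_transv vactD; congr (_ + _).
rewrite -[in RHS](Ua h Uh) (sform_vact _ _ (subsetP sUS h Uh)) Ua //.
case: (F2_cases (sform v a)) => ->; first by rewrite !scale0r vact0.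
by rewrite !scale1r Ua.
Qed.

End SymplecticAction.

(** * The natural action of Sp_6(2) on row vectors *)

Section NaturalAction.
Import GRing.Theory.
Local Open Scope ring_scope.

Notation V := 'rV['F_2]_6.

Definition row_act (v : V) (g : {'GL_6(2)}) : V := v *m GLval g.

Lemma row_act1 : row_act^~ 1%g =1 id.
Proof. by move=> v; rewrite /row_act GL_1E mulmx1. Qed.

Lemma row_actM v : act_morph row_act v.
Proof. by move=> g h; rewrite /row_act GL_MxE mulmxA. Qed.

Definition row_action := TotalAction row_act1 row_actM.

Lemma row_actionD g : {morph row_action^~ g : u v / u + v}.
Proof. by move=> u v; rewrite /= /row_act mulmxDl. Qed.

Lemma sform_row_action g (u v : V) : g \in Sp6F2 ->
  sform (row_action u g) (row_action v g) = sform u v.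
Proof.
rewrite inE => /eqP gJ; rewrite /sform /= /row_act trmx_mul.
by rewrite -{2}gJ !mulmxA.
Qed.

Lemma row_action_faithful g : row_action^~ g =1 id -> g = 1%g.
Proof.
move=> g1; apply/val_inj/row_matrixP=> i.
by rewrite !rowE [LHS](g1 (delta_mx 0 i)) mulmx1.
Qed.

Definition transvection_mx (a : V) : 'M['F_2]_6 :=
  1%:M + symplectic_form *m a^T *m a.

Lemma mul_transvection_mx (a v : V) :
  v *m transvection_mx a = v + sform v a *: a.
Proof.
rewrite mulmxDr mulmx1 !mulmxA; congr (_ + _).
by rewrite [v *m _ *m _]mx11_scalar mul_scalar_mx.
Qed.

Lemma transvection_mxK a : transvection_mx a *m transvection_mx a = 1%:M.
Proof.
apply/row_matrixP=> i; rewrite rowE mulmxA !mul_transvection_mx rowE mulmx1.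
move: (delta_mx 0 i) => v; case: (F2_cases (sform v a)) => va.
  by rewrite va scale0r addr0 va scale0r addr0.
by rewrite va scale1r sformDl va sformxx addr0 scale1r addV2K.
Qed.

Lemma transvection_unit a : transvection_mx a \is a GRing.unit.
Proof. by case: (mulmx1_unit (transvection_mxK a)). Qed.

Definition transvection a : {'GL_6(2)} := FinRing.unit _ (transvection_unit a).

Lemma row_action_transvection a v :
  row_action v (transvection a) = v + sform v a *: a.
Proof. exact: mul_transvection_mx. Qed.

Lemma transvection_Sp a : transvection a \in Sp6F2.
Proof.
rewrite inE; apply/eqP; apply/matrixP=> i j.
pose e (k : 'I_6) : V := delta_mx 0 k.
(* Entrywise, the matrix identity says that the transvection preserves [sform] on basis vectors. *)
have entry (A : 'M['F_2]_6) : A i j = (e i *m A *m (e j)^T) 0 0.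
  by rewrite -rowE trmx_delta -colE !mxE.
rewrite entry [RHS]entry -/(sform (e i) (e j)) !mulmxA -[_ *m _^T *m _]mulmxA.
rewrite -trmx_mul -/(sform (e i *m _) (e j *m _)) !mul_transvection_mx.
move: (e i) (e j) => u v.
rewrite !sformDl !sformDr !sformZr ![sform (_ *: a) _]sformC !sformZr sformxx.
by rewrite !mulr0 addr0 [sform v a * _]mulrC addF2K.
Qed.

Lemma dvd_card_Sp6F2 : (#|Sp6F2| %| 36 * 36 * (2 ^ 11 * 5 * 7 ^ 2 * 31))%N.
Proof.
have := cardSg (subsetT [group of Sp6F2]).
congr (_ %| _)%N; rewrite card_GL // card_Fp //.
rewrite [in X in (_ * X)%N]unlock /=.
have -> : 'C(6, 2) = 15%N by [].
lia.
Qed.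

Lemma Sp6F2_index36_fusion (H U : {group {'GL_6(2)}}) g :
    H \subset Sp6F2 -> #|Sp6F2 : H| = 36%N -> g \in Sp6F2 ->
    U \subset H -> U :^ g \subset H ->
  exists2 h, h \in H & U :^ g = U :^ h.
Proof.
move=> sHS indexH Sg sUH sUgH.
have [q Eq defH] := @index36_stabilizer _ [group of Sp6F2] row_action
  row_actionD sform_row_action transvection transvection_Sp
  row_action_transvection row_action_faithful dvd_card_Sp6F2 H sHS indexH.
rewrite defH in sUH sUgH *.
exact: (@stabilizer_controls_fusion _ [group of Sp6F2] row_action row_actionD
  sform_row_action transvection transvection_Sp row_action_transvection
  row_action_faithful q U g Eq Sg sUH sUgH).
Qed.

End NaturalAction.

(** * Transfer along the isomorphism with Sp_6(2) *)

Theorem corollaryA4 (gT : finGroupType) (G U36 : {group gT})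
    (isoG : G \isog Sp6F2)
    (sU36G : U36 \subset G) (indexU36 : #|G : U36| = 36%N)
    (U1 U2 : {group gT})
    (sU1 : U1 \subset U36) (sU2 : U2 \subset U36) :
  conjugate_in G U1 U2 -> conjugate_in U36 U1 U2.
Proof.
case=> g Gg U2E; have [f injf imf] := isogP isoG.
have sS (A : {set gT}) : A \subset G -> f @* A \subset Sp6F2.
  by move=> sAG; rewrite -[Sp6F2]imf morphimS.
have [sU1G sU2G] := (subset_trans sU1 sU36G, subset_trans sU2 sU36G).
have [|||||h Uh fU] := @Sp6F2_index36_fusion (f @* U36)%G (f @* U1)%G (f g).
- exact: sS.
- by rewrite -[Sp6F2]imf -indexU36 index_injm.
- by rewrite -[Sp6F2]imf mem_morphim.
- exact: morphimS.
- by rewrite -morphimJ // -U2E morphimS.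
(* The conjugating element is pulled back to [U36]; injectivity of [f] on [G] then reflects equality
   of the images. *)
have /morphimP[k Gk Uk def_h] := Uh.
exists k => //; rewrite U2E; apply: (injm_morphim_inj injf).
- by rewrite -(conjGid Gg) conjSg.
- by rewrite -(conjGid Gk) conjSg.
by rewrite !morphimJ // fU def_h.
Qed.
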